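(* Let $\Sigma$ be a finite signature containing two distinct atoms $p_1,p_2$. Then there is no formula $\gamma$ built from atoms of $\Sigma$ using only the connectives $\bot,\vee,\wedge$ such that $[\![\gamma]\!]=[\![p_1\to p_2]\!]$.
   Context: $\Sigma$ is a finite set of atoms. Formulas are given by $\alpha ::= \bot \mid p \mid \alpha_1\wedge\alpha_2 \mid \alpha_1\vee\alpha_2 \mid \alpha_1\rightarrow\alpha_2$ with $p\in\Sigma$. A partial interpretation is a map $v:\Sigma\to\{0,1,2\}$; $\mathcal I$ is the set of all of them and $\mathcal I_c$ the set of classical ones (no atom mapped to $1$). The order on $\mathcal I$: $u\le v$ iff for every atom $p$, $u(p)\le v(p)$ and ($u(p)=0$ implies $v(p)=0$). For $S\subseteq\mathcal I$: $\overline S=\mathcal I\setminus S$; $S_c=S\cap\mathcal I_c$; $S\downarrow=\{u\in\mathcal I:\exists v\in S,\ v\ge u\}$ (so $S_c\downarrow=(S_c)\downarrow$). The denotation: $[\![\bot]\!]=\emptyset$; $[\![p]\!]=\{v\in\mathcal I: v(p)=2\}$; $[\![\alpha\wedge\beta]\!]=[\![\alpha]\!]\cap[\![\beta]\!]$; $[\![\alpha\vee\beta]\!]=[\![\alpha]\!]\cup[\![\beta]\!]$; $[\![\alpha\to\beta]\!]=\big(\overline{[\![\alpha]\!]}\cup[\![\beta]\!]\big)\cap\big(\overline{[\![\alpha]\!]}\cup[\![\beta]\!]\big)_c\downarrow$. *)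

(* Defs.v *)
From mathcomp Require Import all_boot.

Set Implicit Arguments.
Unset Strict Implicit.
Unset Printing Implicit Defensive.

Inductive formula (Sigma : Type) : Type :=
| Bot
| Atom of Sigma
| And of formula Sigma & formula Sigma
| Or of formula Sigma & formula Sigma
| Imp of formula Sigma & formula Sigma.

Arguments Bot {Sigma}.

Fixpoint imp_free (Sigma : Type) (a : formula Sigma) : bool :=
  match a with
  | Bot => true
  | Atom _ => true
  | And b c => imp_free b && imp_free c
  | Or b c => imp_free b && imp_free c
  | Imp _ _ => false
  end.

Definition interp (Sigma : finType) := {ffun Sigma -> 'I_3}.

Definition classical (Sigma : finType) (v : interp Sigma) : bool :=
  [forall p, v p != 1 :> nat].

Definition interp_le (Sigma : finType) (u v : interp Sigma) : bool :=
  [forall p, (u p <= v p) && ((u p == 0 :> nat) ==> (v p == 0 :> nat))].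

Definition classical_part (Sigma : finType) (S : {set interp Sigma}) :
    {set interp Sigma} :=
  S :&: [set v | classical v].

Definition down (Sigma : finType) (S : {set interp Sigma}) :
    {set interp Sigma} :=
  [set u | [exists v in S, interp_le u v]].

Fixpoint den (Sigma : finType) (a : formula Sigma) : {set interp Sigma} :=
  match a with
  | Bot => set0
  | Atom p => [set v : interp Sigma | v p == 2 :> nat]
  | And b c => den b :&: den c
  | Or b c => den b :|: den c
  | Imp b c =>
      (~: den b :|: den c) :&: down (classical_part (~: den b :|: den c))
  end.

(* Main.v *)
(** Implication-free denotations are monotone in the set of atoms with value [2].
    The denotation of [p1 -> p2] is not: it contains the all-[0] interpretation,
    but not the one that raises only [p1] to [2]. *)

Require Import Defs.
From mathcomp Require Import all_boot.

(** Atoms only test for the value 2, and unions and intersections preserve monotonicity. *)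
Lemma den_imp_free_mono (Sigma : finType) (gamma : formula Sigma)
    (u v : interp Sigma) :
  imp_free gamma -> (forall p, u p = 2 :> nat -> v p = 2 :> nat) ->
  u \in den gamma -> v \in den gamma.
Proof.
move=> + uv; elim: gamma => [|p|b IHb c IHc|b IHb c IHc|//] /=.
- by rewrite inE.
- by rewrite !inE => _ /eqP /uv /eqP.
- by move=> /andP[/IHb {}IHb /IHc {}IHc]; rewrite !inE => /andP[/IHb -> /IHc ->].
- move=> /andP[/IHb {}IHb /IHc {}IHc]; rewrite !inE.
  by case/orP => [/IHb -> //|/IHc ->]; rewrite orbT.
Qed.

Lemma interp_le_refl (Sigma : finType) (v : interp Sigma) : interp_le v v.
Proof. by apply/forallP => p; rewrite leqnn implybb. Qed.

(** A classical [v] is its own classical witness above [v], so the [down] condition is automatic. *)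
Lemma den_Imp_classical (Sigma : finType) (a b : formula Sigma)
    (v : interp Sigma) :
  classical v -> (v \in den (Imp a b)) = (v \in ~: den a :|: den b).
Proof.
move=> cv; rewrite /= in_setI andb_idr // => vab.
rewrite inE; apply/existsP; exists v.
by rewrite interp_le_refl andbT in_setI vab inE.
Qed.

Theorem theorem4 (Sigma : finType) (p1 p2 : Sigma) (p1_neq_p2 : p1 <> p2) :
  ~ (exists gamma : formula Sigma,
       imp_free gamma /\ den gamma = den (Imp (Atom p1) (Atom p2))).
Proof.
case=> gamma [gamma_free den_gamma].
pose u : interp Sigma := [ffun _ => ord0].
pose v : interp Sigma := [ffun p => if p == p1 then ord_max else ord0].
have u_in : u \in den gamma.
  rewrite den_gamma den_Imp_classical; first by rewrite !inE !ffunE.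
  by apply/forallP => p; rewrite ffunE.
(* Vacuous: [u] never takes the value 2. *)
have uv p : u p = 2 :> nat -> v p = 2 :> nat by rewrite ffunE.
have := den_imp_free_mono _ _ _ _ gamma_free uv u_in.
rewrite den_gamma den_Imp_classical; last first.
  by apply/forallP => p; rewrite ffunE; case: (p == p1).
(* Since [v p1] is 2, membership would force [v p2] to be 2, hence [p2 = p1]. *)
by rewrite !inE !ffunE eqxx; case: (p2 =P p1) => // /esym.
Qed.
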